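(* Every symmetric Archimedean ordered $^*$-algebra is radical.
   Context: A $^*$-algebra is a unital associative complex algebra $\mathcal{A}$ (unit $\mathbb{1}$) with an antilinear involution $a\mapsto a^*$ satisfying $(ab)^*=b^*a^*$; $\mathcal{A}_{\mathrm{H}}=\{a\in\mathcal{A}: a=a^*\}$. An ordered $^*$-algebra is a $^*$-algebra $\mathcal{A}$ with a partial order $\le$ on $\mathcal{A}_{\mathrm{H}}$ such that $a+c\le b+c$, $d^*ad\le d^*bd$ and $0\le\mathbb{1}$ for all $a,b,c\in\mathcal{A}_{\mathrm{H}}$ with $a\le b$ and all $d\in\mathcal{A}$. It is Archimedean if, for $v,w\in\mathcal{A}_{\mathrm{H}}$, $v\le\epsilon w$ for all $\epsilon>0$ implies $v\le 0$. An element $a\in\mathcal{A}_{\mathrm{H}}$ is coercive if $a\ge\epsilon\mathbb{1}$ for some $\epsilon>0$. $\mathcal{A}$ is symmetric if every coercive element of $\mathcal{A}_{\mathrm{H}}$ has a multiplicative inverse in $\mathcal{A}$. $\mathcal{A}$ is radical if, whenever $a,b\in\mathcal{A}_{\mathrm{H}}$ commute, $a$ is coercive and $ab\ge 0$, then $b\ge 0$. *)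

(* Defs.v *)
From HB Require Import structures.
From mathcomp Require Import all_boot all_order all_algebra.
From mathcomp Require Import reals.
From mathcomp Require Import complex.

Set Implicit Arguments.
Unset Strict Implicit.
Unset Printing Implicit Defensive.

Import Order.TTheory GRing.Theory Num.Theory.
Local Open Scope ring_scope.
Local Open Scope complex_scope.

(* A unital associative complex algebra with scaling [cscale]. [algType] is not
   used because its objects are nontrivial rings, whereas the zero algebra is a
   legitimate *-algebra; and Hierarchy Builder does not allow [pzRingType] and
   [lmodType] to be joined after the library has declared [algType]. *)
HB.mixin Record PzRing_isUnitalAlgebra (R : realType) A of GRing.PzRing A := {
  cscale : R[i] -> A -> A;
  cscaleA : forall (y z : R[i]) (a : A),
    cscale y (cscale z a) = cscale (y * z) a;
  cscale1 : forall a : A, cscale 1 a = a;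
  cscaleDr : forall (z : R[i]) (a b : A),
    cscale z (a + b) = cscale z a + cscale z b;
  cscaleDl : forall (a : A) (y z : R[i]),
    cscale (y + z) a = cscale y a + cscale z a;
  cscale_mull : forall (z : R[i]) (a b : A),
    cscale z (a * b) = cscale z a * b;
  cscale_mulr : forall (z : R[i]) (a b : A),
    cscale z (a * b) = a * cscale z b
}.

#[short(type="unitalAlgType")]
HB.structure Definition UnitalAlgebra (R : realType) :=
  {A of GRing.PzRing A & PzRing_isUnitalAlgebra R A}.

HB.mixin Record hasStar (R : realType) A of UnitalAlgebra R A := {
  star : A -> A;
  starD : forall a b : A, star (a + b) = star a + star b;
  starZ : forall (z : R[i]) (a : A), star (cscale z a) = cscale (conjc z) (star a);
  starM : forall a b : A, star (a * b) = star b * star a;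
  starK : forall a : A, star (star a) = a
}.

#[short(type="starAlgType")]
HB.structure Definition StarAlgebra (R : realType) :=
  {A of UnitalAlgebra R A & hasStar R A}.

Definition is_herm (R : realType) (A : starAlgType R) (a : A) : Prop :=
  a = star a.

(* The order lives on the Hermitian elements only: [hle] is a relation on the
   whole of [A] for convenience, but it is constrained, and may be used, only
   between Hermitian elements; its values elsewhere are irrelevant. *)
HB.mixin Record hasHermOrder (R : realType) A of StarAlgebra R A := {
  hle : A -> A -> Prop;
  hle_refl : forall a : A, is_herm a -> hle a a;
  hle_anti : forall a b : A, is_herm a -> is_herm b ->
    hle a b -> hle b a -> a = b;
  hle_trans : forall a b c : A, is_herm a -> is_herm b -> is_herm c ->
    hle a b -> hle b c -> hle a c;
  hle_add2r : forall a b c : A, is_herm a -> is_herm b -> is_herm c ->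
    hle a b -> hle (a + c) (b + c);
  hle_conj : forall a b d : A, is_herm a -> is_herm b ->
    hle a b -> hle (star d * a * d) (star d * b * d);
  hle01 : hle (0 : A) 1
}.

#[short(type="orderedStarAlgType")]
HB.structure Definition OrderedStarAlgebra (R : realType) :=
  {A of StarAlgebra R A & hasHermOrder R A}.

Section Properties.
Variables (R : realType) (A : orderedStarAlgType R).

Definition archimedean_star_alg : Prop :=
  forall v w : A, is_herm v -> is_herm w ->
    (forall eps : R, 0 < eps -> hle v (cscale eps%:C w)) -> hle v 0.

Definition coercive (a : A) : Prop :=
  is_herm a /\ exists2 eps : R, 0 < eps & hle (cscale eps%:C 1) a.

Definition symmetric_star_alg : Prop :=
  forall a : A, coercive a -> exists b : A, a * b = 1 /\ b * a = 1.

(* Here [a * b] is Hermitian because [a] and [b] commute. *)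
Definition radical_star_alg : Prop :=
  forall a b : A, is_herm a -> is_herm b -> a * b = b * a ->
    coercive a -> hle 0 (a * b) -> hle 0 b.

End Properties.

(* Main.v *)
(** The inverse of a coercive element is, up to scaling, an [x] with
    [0 <= x <= 1], so it suffices that [x p >= 0] for every [p >= 0] commuting
    with such an [x].  Put [x_0 = x] and [x_(k+1) = x_k - x_k^2].  Then
    [0 <= x_k <= 1] and [x = x_n + \sum_(k < n) x_k^2], whence [x p >= x_k p]
    and [\sum_(k < n) x_k^2 <= 1].  Summing [(p + m x_k)^2 >= 0] over
    [k < m^2] yields [p^2 + 2 m x p + 1 >= 0] for all [m], and the Archimedean
    property gives [x p >= 0], even though [p] may be unbounded. *)

Require Import Defs.
From HB Require Import structures.
From mathcomp Require Import all_boot all_order all_algebra.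
From mathcomp Require Import reals.
From mathcomp Require Import complex.

Import Order.TTheory GRing.Theory Num.Theory.
Local Open Scope ring_scope.
Local Open Scope complex_scope.

(** * Hermitian elements *)

Section Hermitian.
Context {R : realType} {A : starAlgType R}.
Implicit Types a b : A.

Lemma star0 : star (0 : A) = 0.
Proof. by apply: (addrI (star (0 : A))); rewrite -starD !addr0. Qed.

Lemma starN a : star (- a) = - star a.
Proof. by apply: (addrI (star a)); rewrite -starD !subrr star0. Qed.

Lemma star1 : star (1 : A) = 1.
Proof. by rewrite -[RHS](starK 1) -[in RHS](mulr1 (star 1)) starM starK mulr1. Qed.

Lemma herm0 : is_herm (0 : A). Proof. by rewrite /is_herm star0. Qed.

Lemma herm1 : is_herm (1 : A). Proof. by rewrite /is_herm star1. Qed.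

Lemma hermN a : is_herm a -> is_herm (- a).
Proof. by rewrite /is_herm starN => <-. Qed.

Lemma hermD a b : is_herm a -> is_herm b -> is_herm (a + b).
Proof. by rewrite /is_herm starD => <- <-. Qed.

Lemma hermB a b : is_herm a -> is_herm b -> is_herm (a - b).
Proof. by move=> ha hb; apply: hermD => //; apply: hermN. Qed.

Lemma hermM a b : is_herm a -> is_herm b -> GRing.comm a b -> is_herm (a * b).
Proof. by rewrite /is_herm starM => <- <-. Qed.

Lemma hermMn a n : is_herm a -> is_herm (a *+ n).
Proof.
by move=> ha; elim: n => [|n IH]; [apply: herm0 | rewrite mulrS; apply: hermD].
Qed.

Lemma hermZ (r : R) a : is_herm a -> is_herm (cscale r%:C a).
Proof. by rewrite /is_herm starZ conjc_real => <-. Qed.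

Lemma herm_conj a b : is_herm a -> is_herm (star b * a * b).
Proof. by rewrite /is_herm !starM starK mulrA => <-. Qed.

Lemma cscale_nat n a : cscale (n.+1%:R : R)%:C a = a *+ n.+1.
Proof.
elim: n => [|n IH]; first exact: cscale1.
by rewrite mulrS [RHS]mulrS rmorphD cscaleDl IH cscale1.
Qed.

End Hermitian.

(** * The positive cone of the order *)

Section Positive.
Context {R : realType} {A : orderedStarAlgType R}.
Implicit Types a b p x : A.

(** [hle] is meaningful only between Hermitian elements, so hermiticity is bundled with
    positivity. *)
Definition psd a : Prop := is_herm a /\ hle 0 a.

Lemma hle_psd a b : is_herm a -> is_herm b -> hle a b -> psd (b - a).
Proof.
move=> ha hb ab; split; first exact: hermB.
by rewrite -(subrr a); apply: hle_add2r => //; apply: hermN.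
Qed.

Lemma psd_hle a b : is_herm a -> is_herm b -> psd (b - a) -> hle a b.
Proof.
move=> ha hb [hba p]; rewrite -[a]add0r -[b](subrK a).
by apply: hle_add2r => //; apply: herm0.
Qed.

Lemma psd0 : psd 0.
Proof. by split; [apply: herm0 | apply: hle_refl; apply: herm0]. Qed.

Lemma psd1 : psd 1.
Proof. by split; [apply: herm1 | apply: hle01]. Qed.

Lemma psdD a b : psd a -> psd b -> psd (a + b).
Proof.
move=> [ha pa] [hb pb]; have hab := hermD _ _ ha hb; split=> //.
apply: (hle_trans 0 b) => //; first exact: herm0.
by rewrite -{1}[b]add0r; apply: hle_add2r => //; apply: herm0.
Qed.

Lemma psdMn a n : psd a -> psd (a *+ n).
Proof.
by move=> pa; elim: n => [|n IH]; [apply: psd0 | rewrite mulrS; apply: psdD].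
Qed.

Lemma psd_conj a b : psd a -> psd (star b * a * b).
Proof.
move=> [ha pa]; split; first exact: herm_conj.
by rewrite -(mul0r b) -{1}(mulr0 (star b)); apply: hle_conj => //; apply: herm0.
Qed.

Lemma psd_hconj a b : is_herm b -> psd a -> psd (b * a * b).
Proof. by move=> hb pa; rewrite {1}hb; apply: psd_conj. Qed.

Lemma psd_sqr a : is_herm a -> psd (a * a).
Proof. by move=> ha; rewrite -[X in X * _]mulr1; apply: psd_hconj psd1. Qed.

(** The order axioms do not mention real scalars; scaling by [r] is conjugation by the Hermitian
    element [s], the square root of [r] times the unit. *)
Lemma psdZ (r : R) a : 0 <= r -> psd a -> psd (cscale r%:C a).
Proof.
move=> r0 pa; set s := cscale (Num.sqrt r)%:C (1 : A).
have -> : cscale r%:C a = s * a * s.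
  rewrite /s -cscale_mull mul1r -cscale_mulr mulr1 cscaleA -rmorphM.
  by rewrite -expr2 sqr_sqrtr.
by apply: psd_hconj => //; apply: hermZ; apply: herm1.
Qed.

Lemma psdMnI a n : psd (a *+ n.+1) -> psd a.
Proof.
rewrite -(@cscale_nat R) => /(psdZ (n.+1%:R^-1)); rewrite cscaleA -rmorphM.
by rewrite mulVf ?pnatr_eq0 // cscale1; apply; rewrite invr_ge0 ler0n.
Qed.

(** * Iterating [sub_sqr] on the unit interval *)

Definition sub_sqr x : A := x - x * x.

(** Products of commuting positive elements are not yet known to be positive, so [x - x * x] is
    split into two conjugates, [(1 - x) * x * (1 - x)] and [x * (1 - x) * x]. *)
Lemma sub_sqr_unit_interval x :
  psd x -> psd (1 - x) -> psd (sub_sqr x) /\ psd (1 - sub_sqr x).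
Proof.
move=> px qx; split.
  have -> : sub_sqr x = (1 - x) * x * (1 - x) + x * (1 - x) * x.
    have -> : x * (1 - x) = (1 - x) * x by rewrite mulrBl mulrBr mul1r mulr1.
    by rewrite -mulrDr subrK mulr1 mulrBl mul1r.
  by apply: psdD; apply: psd_hconj => //; [case: qx | case: px].
have -> : 1 - sub_sqr x = (1 - x) + x * x by rewrite /sub_sqr opprB addrA addrAC.
by apply: psdD => //; apply: psd_sqr; case: px.
Qed.

Lemma iter_sub_sqr_unit_interval x n : psd x -> psd (1 - x) ->
  psd (iter n sub_sqr x) /\ psd (1 - iter n sub_sqr x).
Proof.
by move=> px qx; elim: n => [//|n [p1 p2]]; apply: sub_sqr_unit_interval.
Qed.

Lemma comm_iter_sub_sqr p x n :
  GRing.comm p x -> GRing.comm p (iter n sub_sqr x).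
Proof. by move=> c; elim: n => //= n IH; apply: commrB => //; apply: commrM. Qed.

(** Since [p] commutes with every iterate [x_k], the product is the sum of the conjugates
    [x_k p x_k] over [k < n]. *)
Lemma psd_iter_sub_sqr_mul x p n : psd x -> psd (1 - x) -> psd p ->
  GRing.comm p x -> psd ((x - iter n sub_sqr x) * p).
Proof.
move=> px qx pp cpx; elim: n => [|n IH]; first by rewrite subrr mul0r; apply: psd0.
have [[hy _] _] := iter_sub_sqr_unit_interval x n px qx.
have cpy := comm_iter_sub_sqr p x n cpx.
rewrite /=; move: (iter n _ _) hy cpy IH => y hy cpy IH.
have -> : (x - sub_sqr y) * p = (x - y) * p + y * p * y.
  by rewrite -(mulrA y p) cpy mulrA -mulrDl /sub_sqr opprB addrA addrAC.
by apply: psdD => //; apply: psd_hconj.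
Qed.

(** The squares [(p + m x_k)^2] are summed over [k < n], and the [x_k^2] telescope to [x - x_n].
    Keeping [n] independent of [m] allows induction on [n]. *)
Lemma psd_add_mul_sqr x p m n : psd x -> psd (1 - x) -> psd p ->
    GRing.comm p x ->
  psd ((p * p + (x * p) *+ m *+ 2) *+ n + (x - iter n sub_sqr x) *+ (m * m)).
Proof.
move=> px qx pp cpx; elim: n => [|n IH].
  by rewrite mulr0n subrr mul0rn addr0; apply: psd0.
have [[hy _] _] := iter_sub_sqr_unit_interval x n px qx.
have cpy := comm_iter_sub_sqr p x n cpx.
have pxy := psd_iter_sub_sqr_mul x p n px qx pp cpx.
rewrite iterS; move: (iter n _ _) hy cpy pxy IH => y hy cpy pxy IH.
(* Replacing [y * p] by [x * p] in the expanded square adds a multiple of [(x - y) * p], positive by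
   [pxy]. *)
have step : psd (p * p + (x * p) *+ m *+ 2 + (y * y) *+ (m * m)).
  have -> : p * p + (x * p) *+ m *+ 2 + (y * y) *+ (m * m) =
      (p + y *+ m) * (p + y *+ m) + ((x - y) * p) *+ m *+ 2.
    have -> : x * p = y * p + (x - y) * p by rewrite mulrBl addrC subrK.
    move: ((x - y) * p) => z.
    rewrite mulrDl !mulrDr !mulrnAl !mulrnAr cpy !mulrnDl -mulrnA -!addrA.
    congr (_ + _); rewrite [RHS]addrA -mulr2n -!mulrnA; congr (_ + _).
    by rewrite addrA -mulr2n -mulrnA addrC.
  apply: psdD; last by do 2!apply: psdMn.
  by apply: psd_sqr; apply: hermD; [case: pp | apply: hermMn].
have -> : x - sub_sqr y = (x - y) + y * y by rewrite /sub_sqr opprB addrA addrAC.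
rewrite [_ *+ n.+1]mulrSr [(x - y + _) *+ _]mulrnDl addrACA.
exact: psdD.
Qed.

Lemma psd_add_mul_sqr1 x p m : psd x -> psd (1 - x) -> psd p ->
  GRing.comm p x -> psd (p * p + (x * p) *+ m.+1 *+ 2 + 1).
Proof.
move=> px qx pp cpx; set N := (m.+1 * m.+1)%N.
have [py _] := iter_sub_sqr_unit_interval x N px qx.
(* [N] is, by computation, the successor of [m + m * m.+1]. *)
apply: (psdMnI _ (m + m * m.+1)); rewrite -[X in _ *+ X]/N.
have := psd_add_mul_sqr x p m.+1 N px qx pp cpx.
(* Adding [N] copies of [(1 - x) + y] turns [x - y] into [1]. *)
rewrite -/N => /psdD/(_ (psdMn _ N (psdD _ _ qx py))).
have e y : x - y + (1 - x + y) = 1 by rewrite addrCA !subrK.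
by rewrite -addrA -!mulrnDl e.
Qed.

(** * Positivity of products and of inverses *)

Lemma psd_comm_mul x p : archimedean_star_alg A ->
  psd x -> psd (1 - x) -> psd p -> GRing.comm p x -> psd (x * p).
Proof.
move=> Aarch px qx pp cpx.
have hxp : is_herm (x * p).
  by apply: hermM; [case: px | case: pp | apply: commr_sym].
have hw : is_herm (p * p + 1) by apply: hermD herm1; apply: (psd_sqr p _).1; case: pp.
rewrite -[x * p]opprK -[- - _]add0r.
apply: hle_psd herm0 _; first exact: hermN.
(* The comparison element is [p * p + 1] rather than [1], because [p] need not be bounded. *)
apply: Aarch (hermN _ hxp) (hw) _ => eps eps0.
apply: psd_hle; [exact: hermN | exact: hermZ | rewrite opprK].
(* [n.+1] is [2 (m + 1)], the multiplicity of [x * p] in [psd_add_mul_sqr1], and [m + 1] exceeds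
   [eps^-1]. *)
pose m := Num.truncn eps^-1; pose n := (m.*2.+1)%N.
have mP : n.+1%:R^-1 <= eps.
  rewrite invf_ple ?posrE ?ltr0n //; apply: (le_trans (ltW (truncnS_gt _))).
  by rewrite ler_nat ltnS /n -addnn -addnS leq_addr.
have -> : cscale eps%:C (p * p + 1) + x * p =
    cscale (eps - n.+1%:R^-1)%:C (p * p + 1) +
    cscale (n.+1%:R^-1)%:C (p * p + (x * p) *+ m.+1 *+ 2 + 1).
  rewrite (addrAC (p * p)) [in RHS](cscaleDr _ (_ + 1)) addrA -cscaleDl -rmorphD subrK.
  congr (_ + _).
  rewrite -mulrnA muln2 doubleS -/n -(@cscale_nat R) cscaleA -rmorphM.
  by rewrite mulVf ?pnatr_eq0 // cscale1.
apply: psdD; apply: psdZ.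
- by rewrite subr_ge0.
- by apply: psdD psd1; apply: psd_sqr; case: pp.
- by rewrite invr_ge0 ler0n.
- exact: psd_add_mul_sqr1.
Qed.

(** Everything follows from [c - c * c = c * (a - 1) * c], which is positive: adding [c * c] gives
    [c], and adding [(1 - c) * (1 - c)] gives [1 - c]. *)
Lemma psd_inv a c : psd (a - 1) -> a * c = 1 -> c * a = 1 ->
  psd c /\ psd (1 - c).
Proof.
move=> pa ac ca.
have ha : is_herm a by rewrite -(subrK 1 a); apply: hermD herm1; case: pa.
have hc : is_herm c.
  have sca : star c * a = 1 by rewrite {1}ha -starM ac star1.
  by rewrite /is_herm -[RHS]mulr1 -ac mulrA sca mul1r.
have pcc := psd_sqr _ hc.
have pd : psd (c - c * c).
  have -> : c - c * c = c * (a - 1) * c by rewrite mulrBr ca mulr1 mulrBl mul1r.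
  exact: psd_hconj.
split; first by rewrite -(subrK (c * c) c); apply: psdD.
have -> : 1 - c = (1 - c) * (1 - c) + (c - c * c).
  by rewrite mulrBr mulr1 mulrBl mul1r subrK.
by apply: psdD pd; apply: psd_sqr; apply: hermB hc; apply: herm1.
Qed.

End Positive.

Theorem proposition4p8 (R : realType) (A : orderedStarAlgType R)
  (Asym : symmetric_star_alg A) (Aarch : archimedean_star_alg A) :
  radical_star_alg A.
Proof.
move=> a b ha hb cab [_ [eps eps0 ea]] ab0.
have pab : psd (a * b) by split=> //; apply: hermM.
have peps : 0 <= eps^-1 by rewrite invr_ge0 ltW.
(* Rescaling makes [a'] at least [1], so that its inverse [c] lies between [0] and [1]. *)
pose a' := cscale (eps^-1)%:C a.
have pa' : psd (a' - 1).
  have := psdZ _ _ peps (hle_psd _ _ (hermZ eps _ herm1) ha ea).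
  have -> : - cscale eps%:C (1 : A) = cscale eps%:C (- 1).
    by rewrite -mulN1r cscale_mulr mulN1r.
  rewrite cscaleDr cscaleA -rmorphM mulVf ?cscale1 //; exact: lt0r_neq0.
have ca' : coercive a'.
  split; first by apply: hermZ.
  exists 1 => //; rewrite cscale1; apply: psd_hle pa'; first exact: herm1.
  exact: hermZ.
have [c [ac ca]] := Asym _ ca'.
have [pc qc] := psd_inv _ _ pa' ac ca.
have cba : GRing.comm b a' by rewrite /GRing.comm /a' -cscale_mulr -cab cscale_mull.
have cbc : GRing.comm b c.
  by rewrite /GRing.comm -[b * c]mul1r -ca -mulrA (mulrA a') -cba -!mulrA ac mulr1.
have caa : GRing.comm a' c by rewrite /GRing.comm ac ca.
have pa'b : psd (a' * b) by rewrite -cscale_mull; apply: psdZ.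
(* [b] is recovered as [c * (a' * b)], the product of [c] with a positive element commuting with
   it. *)
have := psd_comm_mul c (a' * b) Aarch pc qc pa'b.
rewrite mulrA ca mul1r => /(_ _)[]//.
by apply: commr_sym; apply: commrM; apply: commr_sym.
Qed.
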